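(* Let $X,U$ be Banach spaces, let $-A$ generate an exponentially stable strongly continuous semigroup $S(t)_{t\ge0}$ on $X$, suppose that $A$ has dense range and that $B\in\mathcal{B}(U,X_{-1})$ is $L^p$-admissible for $A$, where $p\in[1,\infty]$. Let $p'$ be the conjugate exponent of $p$ ($\frac1p+\frac1{p'}=1$). Then $A^{-1}B$ is finite-time $L^{p'}$-admissible for $A^{-1}$.
   Context: For a generator $-A$ of a strongly continuous semigroup $S(\cdot)$ on $X$, the extrapolation space $X_{-1}$ is the completion of $X$ with respect to the norm $\|(\lambda+A)^{-1}\cdot\|$ for some fixed $\lambda\in\varrho(-A)$; the semigroup extends to $X_{-1}$ (same notation). Here exponential stability gives $0\in\varrho(A)$, so $A^{-1}$ is a bounded operator on $X$, extends to a bounded operator $X_{-1}\to X$, and $A^{-1}B\in\mathcal{B}(U,X)$; the semigroup generated by $-A^{-1}$ is $\exp(-tA^{-1})$, and the extrapolation space associated with $A^{-1}$ is $X$ itself (up to equivalent norm). Let $-G$ generate a strongly continuous semigroup $S_G(\cdot)$ on $X$, let $r\in[1,\infty]$ and let $C$ be a bounded operator from $U$ into the extrapolation space of $X$ associated with $G$. $C$ is finite-time $L^r$-admissible for $G$ if for every $\tau>0$ there is a constant $K>0$ such that for all $u\in L^r(0,\tau;U)$ and all $t\in[0,\tau]$ the integral $\int_0^tS_G(t-s)Cu(s)\,ds$ (a Bochner integral in the extrapolation space) takes values in $X$ and $\|\int_0^tS_G(t-s)Cu(s)\,ds\|_X\le K\|u\|_{L^r(0,\tau;U)}$. $C$ is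 (infinite-time) $L^r$-admissible for $G$ if $K$ can be chosen independently of $\tau>0$. *)

(* Defs.v *)
From HB Require Import structures.
From mathcomp Require Export all_boot all_order all_algebra.
From mathcomp Require Export all_classical all_reals all_analysis.
Export Order.TTheory GRing.Theory Num.Theory numFieldNormedType.Exports.
Set Implicit Arguments.
Unset Strict Implicit.
Unset Printing Implicit Defensive.
Local Open Scope classical_set_scope.
Local Open Scope ring_scope.

(** * Unbounded operators and strongly continuous semigroups

    Scalars are real; a complex Banach space is covered through its underlying
    real Banach space. *)

Definition bounded_linear (R : realType) (V W : normedModType R)
    (f : V -> W) : Prop :=
  linear f /\ continuous f.

(** An (in general unbounded) operator on [X] is given by its graph. *)
Definition operator (R : realType) (X : normedModType R) := set (X * X)%type.

Section Operators.
Context {R : realType} {X : normedModType R}.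
Implicit Type G : operator X.

Definition opp_op G : operator X := [set p | G (p.1, - p.2)].

Definition inv_op G : operator X := [set p | G (p.2, p.1)].

Definition range_op G : set X := [set y | exists x, G (x, y)].

(** The map with graph [G], for [G] single-valued and everywhere defined. *)
Definition op_fun G (x : X) : X := xget 0 [set y | G (x, y)].

(** [Q] is the bounded inverse of [lam - G] (defined on the domain of [G]):
    [Q y = x] iff [x] is in the domain of [G] and [lam *: x - G x = y]. *)
Definition is_resolvent G (lam : R) (Q : X -> X) : Prop :=
  bounded_linear Q /\ forall x y, Q y = x <-> G (x, lam *: x - y).

(** Only the values [S t] with [0 <= t] are relevant. *)
Definition C0_semigroup (S : R -> X -> X) : Prop :=
  [/\ forall t, 0 <= t -> bounded_linear (S t),
      forall x, S 0 x = x,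
      forall s t x, 0 <= s -> 0 <= t -> S (s + t) x = S s (S t x)
    & forall x, S h x @[h --> 0^'+] --> x].

Definition generator (S : R -> X -> X) : operator X :=
  [set p | (h^-1 *: (S h p.1 - p.1)) @[h --> 0^'+] --> p.2].

Definition generates G (S : R -> X -> X) : Prop :=
  C0_semigroup S /\ G = generator S.

Definition exponentially_stable (S : R -> X -> X) : Prop :=
  exists M omega : R, 0 < omega /\
    forall t x, 0 <= t -> `|S t x| <= M * expR (- omega * t) * `|x|.

(** [exp_op L t] is the operator exponential [exp (t L)]. *)
Definition exp_op (L : X -> X) (t : R) (x : X) : X :=
  limn (series (fun n => exp_coeff t n *: iter n L x)).

End Operators.

(** * Extrapolation spaces *)

(** [E], with the embedding [j], is a completion of [X] for the norm
    [x |-> |(lam + A)^-1 x|], where [lam] is in the resolvent set of [- A]. *)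
Definition is_extrapolation (R : realType) (X : normedModType R)
    (A : operator X) (E : completeNormedModType R)
    (j : {linear X -> E}) : Prop :=
  exists (lam : R) (Q : X -> X),
    [/\ is_resolvent (opp_op A) lam Q,
        forall x, `|j x| = `|Q x|
      & dense (range j)].

(** The bounded linear extension of [f] along the dense embedding [j]; see
    [extend_unique] and [extendP]. *)
Definition extend (R : realType) (X : normedModType R)
    (E Z : completeNormedModType R) (j : X -> E) (f : X -> Z) : E -> Z :=
  xget (fun=> 0) [set g | bounded_linear g /\ forall x, g (j x) = f x].

Section ExtendTheory.
Context {R : realType} {X : normedModType R} {E Z : completeNormedModType R}.
Variables (j : {linear X -> E}) (f : X -> Z).
Hypothesis j_dense : dense (range j).

Lemma extend_unique (g : E -> Z) :
  bounded_linear g -> (forall x, g (j x) = f x) -> extend j f = g.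
Proof.
move=> [gl gc] gj; rewrite /extend.
have [[_ hc] hj] := @xgetPex _ (fun=> 0)
  [set g | bounded_linear g /\ forall x, g (j x) = f x]
  (ex_intro _ g (conj (conj gl gc) gj)).
move: (xget _ _) hc hj => h hc hj.
apply/funext => e; apply/eqP/negPn/negP => neq.
have dc : continuous (fun z => h z - g z).
  by move=> z; apply: cvgB; [exact: hc | exact: gc].
have [||z [/= + [x _ xz]]] := @j_dense ((fun z => h z - g z) @^-1` [set~ 0]).
- by exists e => /= /eqP; rewrite subr_eq0; apply/negP.
- apply: open_comp => [? _|]; first exact: dc.
  apply: closed_openC; apply: accessible_closed_set1.
  exact/hausdorff_accessible/norm_hausdorff.
by rewrite -xz hj gj subrr.
Qed.

Let approx (e : E) (d : R) : 0 < d -> exists x, `|j x - e| < d.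
Proof.
move=> d0; have [||z [/= ez [x _ xz]]] := @j_dense (ball e d).
- by exists e; exact: ballxx.
- exact: ball_open.
by exists x; rewrite xz distrC; move: ez; rewrite -ball_normE.
Qed.

Lemma extendP (M : R) :
    linear f -> (forall x, `|f x| <= M * `|j x|) ->
  bounded_linear (extend j f) /\ forall x, extend j f (j x) = f x.
Proof.
move=> fl fM0.
pose K := `|M| + 1.
have K0 : 0 < K by rewrite /K ltr_wpDl.
have fM x : `|f x| <= K * `|j x|.
  apply: (le_trans (fM0 x)); rewrite ler_wpM2r // /K.
  by rewrite (le_trans (ler_norm M)) // lerDl.
have fD x y : f (x + y) = f x + f y by have := fl 1 x y; rewrite !scale1r.
have f0 : f 0 = 0.
  by have /eqP := fD 0 0; rewrite addr0 addrC -subr_eq subrr eq_sym => /eqP.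
have fZ a x : f (a *: x) = a *: f x by have := fl a x 0; rewrite f0 !addr0.
have fB x y : f (x - y) = f x - f y by rewrite fD -scaleN1r fZ scaleN1r.
have small (c : R) : (forall d, 0 < d -> c <= K * d) -> c <= 0.
  move=> h; apply/ler_addgt0Pl => d d0; rewrite addr0.
  have := h (d / K) (divr_gt0 d0 K0).
  by rewrite mulrC divfK // gt_eqF.
have lim e : exists z, forall x, `|f x - z| <= K * `|j x - e|.
  have /choice[x_ xP] : forall n : nat, exists x, `|j x - e| < n.+1%:R^-1.
    by move=> n; apply: approx; rewrite invr_gt0.
  have fx_cvg : cvgn (f \o x_).
    apply: cauchy_cvg; apply: cauchy_exP => eps eps0.
    have d0 : 0 < eps / K / 2 by rewrite !divr_gt0.
    have nd : \forall n \near \oo, n.+1%:R^-1 < eps / K / 2.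
      exact: near_infty_natSinv_lt (PosNum d0).
    have [N _ NP] := nd.
    exists (f (x_ N)).
    exists N => // n Nn; rewrite -ball_normE /= -fB.
    apply: (le_lt_trans (fM _)).
    rewrite mulrC -ltr_pdivlMr // linearB /=.
    rewrite -(subrKA e) [X in _ < X](splitr) (le_lt_trans (ler_normD _ _)) //.
    rewrite ltrD //; last by rewrite distrC (lt_trans (xP _)) //; exact: NP.
    by rewrite (lt_trans (xP _)) //; apply: NP => /=.
  exists (limn (f \o x_)) => x.
  have cv : `|f x - (f \o x_) n| @[n --> \oo] --> `|f x - limn (f \o x_)|.
    by apply: cvg_norm; apply: cvgB => //; exact: cvg_cst.
  rewrite -(cvg_lim _ cv) //.
  rewrite -subr_le0; apply: small => d d0.
  rewrite lerBlDr.
  apply: limr_le; first by apply/cvg_ex; eexists; exact: cv.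
  near=> n.
  rewrite /= -fB (le_trans (fM _)) // linearB /= -mulrDr ler_pM2l //.
  rewrite -(subrKA e) (le_trans (ler_normD _ _)) // [leLHS]addrC lerD2r.
  rewrite distrC (le_trans (ltW (xP n))) // ltW //.
  near: n; exact: near_infty_natSinv_lt (PosNum d0).
have /choice[g gP] := lim.
have gj x : g (j x) = f x.
  by have := gP (j x) x; rewrite subrr normr0 mulr0 normr_le0 subr_eq0 => /eqP.
have gl : linear g.
  move=> a e1 e2; apply/eqP; rewrite -subr_eq0 -normr_le0; apply: small => d d0.
  have a0 : 0 < `|a| + 1 by rewrite ltr_wpDl.
  have c0 : 0 < d / 2 / (`|a| + 1) by rewrite !divr_gt0.
  have [x1 /ltW h1] := approx e1 c0.
  have [x2 /ltW h2] := approx e2 c0.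
  have g1 := le_trans (gP e1 x1) (ler_wpM2l (ltW K0) h1).
  have g2 := le_trans (gP e2 x2) (ler_wpM2l (ltW K0) h2).
  have h3 : `|j (a *: x1 + x2) - (a *: e1 + e2)| <= d / 2.
    rewrite linearP opprD addrACA -scalerBr (le_trans (ler_normD _ _)) // normrZ.
    rewrite (le_trans (lerD (ler_wpM2l (normr_ge0 a) h1) h2)) //.
    by rewrite -[X in _ + X]mul1r -mulrDl mulrC divfK ?gt_eqF.
  have g3 := le_trans (gP _ _) (ler_wpM2l (ltW K0) h3).
  rewrite (_ : g _ - _ = (a *: (f x1 - g e1) + (f x2 - g e2)) -
      (f (a *: x1 + x2) - g (a *: e1 + e2))); last first.
    rewrite fl scalerBr addrACA -opprD opprB [RHS]addrC addrA; congr (_ - _).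
    by rewrite subrK.
  rewrite (le_trans (ler_normB _ _)) // [d in K * d]splitr mulrDr lerD //.
  rewrite (le_trans (ler_normD _ _)) // normrZ.
  rewrite (le_trans (lerD (ler_wpM2l (normr_ge0 a) g1) g2)) //.
  rewrite -[X in _ + X]mul1r -mulrDl mulrCA ler_pM2l //.
  by rewrite mulrC divfK ?gt_eqF.
have gM e : `|g e| <= K * `|e|.
  by have := gP e 0; rewrite linear0 f0 !sub0r !normrN.
have gc : continuous g.
  move=> e; apply/cvgrPdist_lt => eps eps0; near=> y.
  have -> : g e - g y = g (e - y).
    by rewrite addrC [e - y]addrC; have := gl (-1) y e; rewrite !scaleN1r => ->.
  rewrite (le_lt_trans (gM _)) // mulrC -ltr_pdivlMr //.
  by near: y; apply: cvgr_dist_lt => //; exact: divr_gt0.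
by rewrite (extend_unique (conj gl gc) gj).
Unshelve. all: by end_near. Qed.

End ExtendTheory.

(** * The Bochner integral with respect to the Lebesgue measure *)

Section Bochner.
Context {R : realType} {E : normedModType R}.
Local Notation mu := (@lebesgue_measure R).

(** A representation of the simple function
    [\sum_(i < step_size) \1_(step_set i) *: step_val i]. *)
Record step_fun := StepFun {
  step_size : nat;
  step_set : 'I_step_size -> set (measurableTypeR R);
  step_val : 'I_step_size -> E;
  step_setP : forall i, measurable (step_set i) }.

Definition step_eval (s : step_fun) (x : R) : E :=
  \sum_(i < step_size s) \1_(step_set i) x *: step_val i.

Definition step_integral (D : set (measurableTypeR R)) (s : step_fun) : E :=
  \sum_(i < step_size s) fine (mu (step_set i `&` D)) *: step_val i.

Definition ae_cvg_step (D : set (measurableTypeR R)) (s : nat -> step_fun)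
    (f : R -> E) : Prop :=
  {ae mu, forall x, D x -> step_eval (s n) x @[n --> \oo] --> f x}.

Definition strongly_measurable (D : set (measurableTypeR R)) (f : R -> E) :
    Prop :=
  exists s : nat -> step_fun, ae_cvg_step D s f.

(** [f] is Bochner integrable on [D] with integral [v], for [D] measurable of
    finite measure. *)
Definition is_bochner_integral (D : set (measurableTypeR R)) (f : R -> E)
    (v : E) : Prop :=
  exists s : nat -> step_fun,
    [/\ ae_cvg_step D s f,
        ((\int[mu]_(x in D) (`|f x - step_eval (s n) x|)%:E)%E
           @[n --> \oo] --> 0%E)
      & step_integral D (s n) @[n --> \oo] --> v].

Definition Lr_norm (r : \bar R) (tau : R) (u : R -> E) : \bar R :=
  'N[mu]_r[(fun s => (`|u s|)%:E) \_ `[0%R, tau]]%E.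

Definition in_Lr (r : \bar R) (tau : R) (u : R -> E) : Prop :=
  strongly_measurable `[0, tau] u /\ (Lr_norm r tau u < +oo)%E.

End Bochner.

(** * Admissibility *)

Section Admissibility.
Context {R : realType} {X U E : completeNormedModType R}.
Variables (S : R -> X -> X) (j : {linear X -> E}) (C : U -> E) (r : \bar R).

(** [S t] extended to the extrapolation space [E]. *)
Definition extrapolated_semigroup (t : R) : E -> E := extend j (j \o S t).

Definition input_bound (tau K : R) : Prop :=
  forall u : R -> U, in_Lr r tau u -> forall t, 0 <= t <= tau ->
    exists x : X,
      is_bochner_integral `[0, t]
        (fun s => extrapolated_semigroup (t - s) (C (u s))) (j x) /\
      ((`|x|)%:E <= K%:E * Lr_norm r tau u)%E.

Definition finite_time_admissible : Prop :=
  forall tau : R, 0 < tau -> exists2 K : R, 0 < K & input_bound tau K.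

Definition admissible : Prop :=
  exists2 K : R, 0 < K & forall tau : R, 0 < tau -> input_bound tau K.

End Admissibility.

(* Main.v *)
From HB Require Import structures.
From mathcomp Require Import ring lra.
Require Import Defs.
From mathcomp Require Import measurable_realfun ess_sup_inf.
Set Implicit Arguments.
Unset Strict Implicit.
Unset Printing Implicit Defensive.
Local Open Scope classical_set_scope.
Local Open Scope ring_scope.

(** Only finite-time admissibility is claimed, and it comes from boundedness
    alone. Exponential stability gives [|x| <= C |A x|], so the closed operator
    [A] has closed range; as the range is dense, [A^-1] is a bounded operator.
    Hence [A^-1 B] is bounded from [U] to [X], [t |-> exp (- t A^-1)] is
    norm-bounded and continuous on bounded intervals, and the extrapolation
    space of [A^-1] is [X] up to an equivalent norm. The convolution integral is
    therefore dominated by a multiple of the norm of [u] in [L^1(0, tau)], which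
    Hoelder's inequality bounds by the norm in [L^p'(0, tau)].

    [lebesgue_measure] lives on the Borel sets, so the norm of a strongly
    measurable function need not be measurable; its integral is then a lower
    integral, insensitive to Borel null sets. *)

(** * Bounded linear maps *)

Section BoundedLinear.
Context {R : realType}.

Section LinearRewriting.
Context {V W : normedModType R} (f : V -> W).
Hypothesis fl : linear f.

Lemma linear_funD x y : f (x + y) = f x + f y.
Proof. by have := fl 1 x y; rewrite !scale1r. Qed.

Lemma linear_fun0 : f 0 = 0.
Proof. by apply: (addIr (f 0)); rewrite -linear_funD !add0r. Qed.

Lemma linear_funZ a x : f (a *: x) = a *: f x.
Proof. by have := fl a x 0; rewrite linear_fun0 !addr0. Qed.

Lemma linear_funB x y : f (x - y) = f x - f y.
Proof. by rewrite linear_funD -scaleN1r linear_funZ scaleN1r. Qed.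

Lemma bounded_linear_norm : continuous f ->
  exists2 K, 0 <= K & forall x, `|f x| <= K * `|x|.
Proof.
move=> fc; pose g : {linear V -> W} :=
  HB.pack f (GRing.isLinear.Build R V W *:%R f fl).
have /linear_boundedP[M [_ MP]] : bounded_near g (nbhs 0).
  by apply/linear_bounded_continuous; exact: fc.
exists (`|M| + 1); first by rewrite addr_ge0.
by apply: MP; rewrite (le_lt_trans (ler_norm M)) // ltrDl.
Qed.

Lemma bounded_linearP K : (forall x, `|f x| <= K * `|x|) -> bounded_linear f.
Proof.
move=> fK; split=> // x; apply/cvgrPdist_lt => e e0.
have K0 : 0 < `|K| + 1 by rewrite ltr_wpDl.
near=> y; rewrite -linear_funB (le_lt_trans (fK _)) //.
apply: (@le_lt_trans _ _ ((`|K| + 1) * `|x - y|)).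
  by rewrite ler_wpM2r // (le_trans (ler_norm K)) // lerDl.
rewrite mulrC -ltr_pdivlMr //.
by near: y; apply: cvgr_dist_lt => //; exact: divr_gt0.
Unshelve. all: by end_near. Qed.
End LinearRewriting.

Lemma dense_seq (V : normedModType R) (D : set V) (y : V) : dense D ->
  exists2 u : nat -> V, forall n, D (u n) & u n @[n --> \oo] --> y.
Proof.
move=> dD; have /choice[u uP] (n : nat) : exists z, D z /\ `|z - y| < n.+1%:R^-1.
  have [||z [/= yz Dz]] := dD (ball y n.+1%:R^-1).
  - by exists y; apply: ballxx; rewrite invr_gt0.
  - exact: ball_open.
  by exists z; split=> //; rewrite distrC; move: yz; rewrite -ball_normE.
exists u => [n|]; first by have [] := uP n.
apply/cvgrPdist_lt => e e0; near=> n; rewrite distrC.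
have [_ /lt_trans->//] := uP n.
by near: n; exact: (near_infty_natSinv_lt (PosNum e0)).
Unshelve. all: by end_near. Qed.

(** The estimate makes [x] a Cauchy sequence. With [y] a convergent sequence of values and [x] its
    preimages, this is the core of the closed range arguments below. *)
Lemma cvg_of_dist_le (V : completeNormedModType R) (W : normedModType R)
    (x : nat -> V) (y : nat -> W) c : cvgn y ->
  (forall m n, `|x m - x n| <= c * `|y m - y n|) -> cvgn x.
Proof.
move=> /cvg_ex[l yl] xy; apply: cauchy_cvg; apply: cauchy_exP => e e0.
have c0 : 0 < `|c| + 1 by rewrite ltr_wpDl.
have [M _ MP] := cvgr_dist_lt _ _ yl _ (divr_gt0 (divr_gt0 e0 c0) (ltr0Sn R 1)).
exists (x M), M => // n /= Mn; rewrite -ball_normE /=.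
apply: (@le_lt_trans _ _ ((`|c| + 1) * `|y M - y n|)).
  by rewrite (le_trans (xy _ _)) // ler_wpM2r // (le_trans (ler_norm c)) // lerDl.
rewrite mulrC -ltr_pdivlMr // -(subrKA l) (le_lt_trans (ler_normD _ _)) //.
rewrite [ltRHS]splitr ltrD //; last exact: MP.
by rewrite distrC; apply: MP => /=.
Qed.

(** The lower bound turns convergence of values into convergence of preimages, so the range is
    closed; being dense, it is the whole space. *)
Lemma bounded_below_onto (V W : completeNormedModType R) (f : {linear V -> W})
    (c K : R) : (forall x, `|f x| <= K * `|x|) -> (forall x, `|x| <= c * `|f x|) ->
  dense (range f) -> forall y, exists x, f x = y.
Proof.
move=> fK fc fd y; have [u uf uy] := dense_seq y fd.
have /choice[x xu] n : exists x, f x = u n by have [x _ <-] := uf n; exists x.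
have /cvg_ex[l xl] : cvgn x.
  apply: (@cvg_of_dist_le _ _ _ u c); first by apply/cvg_ex; exists y.
  by move=> m n; rewrite -!xu -linearB.
exists l; have [_ fcont] := bounded_linearP (linearP f) fK.
have fxl := cvg_comp _ _ xl (fcont l).
rewrite -(cvg_lim (@norm_hausdorff _ _) uy); apply/esym/cvg_lim => //.
by rewrite (_ : u = f \o x) //; apply/funext => n /=; rewrite xu.
Qed.

End BoundedLinear.

(** * Lower integrals and Lebesgue norms *)

Section LowerIntegral.
Context d (T : measurableType d) (R : realType).
Variable mu : {measure set T -> \bar R}.
Import HBNNSimple.
Local Open Scope ereal_scope.

Lemma le_lower_integral (D1 D2 : set T) (f1 f2 : T -> \bar R) :
  (forall x, D1 x -> 0 <= f1 x) -> (forall x, D2 x -> 0 <= f2 x) ->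
  (forall x, (f1 \_ D1) x <= (f2 \_ D2) x) ->
  \int[mu]_(x in D1) f1 x <= \int[mu]_(x in D2) f2 x.
Proof.
move=> f10 f20 f12; rewrite !ge0_integralE //.
apply: le_ereal_sup => _ [h /= hf <-]; exists h => // x.
exact: le_trans (hf x) (f12 x).
Qed.

(** A simple function [h] below [f] on [D] is measurable, so cutting it off on the null set [N]
    keeps its integral, and the result lies below [f] on [D] minus [N]. *)
Lemma lower_integral_setD_null (D N : set T) (f : T -> \bar R) :
  measurable N -> mu N = 0 -> (forall x, D x -> 0 <= f x) ->
  \int[mu]_(x in D) f x = \int[mu]_(x in D `\` N) f x.
Proof.
move=> mN N0 f0; have f0' x : (D `\` N) x -> 0 <= f x by move=> [/f0].
apply/eqP; rewrite eq_le; apply/andP; split; last first.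
  apply: le_lower_integral => // x; rewrite /patch in_setD.
  by case: (boolP (x \in D)) => //=; case: (x \in N) => //=; rewrite inE => /f0.
rewrite [leLHS]ge0_integralE //; apply: ge_ereal_sup => _ [h /= hf <-].
rewrite -integralT_nnsfun (ge0_negligible_integral mN) //; first last.
- by move=> x _; rewrite lee_fin.
- exact/measurable_EFinP.
apply: le_lower_integral => // [x _|x]; first by rewrite lee_fin.
rewrite /patch !in_setD mem_setT /=; have := hf x; rewrite /patch.
by case: (x \in N) => //=; rewrite ?andbF // andbT.
Qed.

End LowerIntegral.

Section LnormFiniteMeasure.
Context d (T : measurableType d) (R : realType).
Variable mu : {measure set T -> \bar R}.
Local Open Scope ereal_scope.

Lemma le_Lnorm q (f g : T -> \bar R) : 0 <= q ->
  (forall x, `|f x| <= `|g x|) -> 'N[mu]_q[f] <= 'N[mu]_q[g].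
Proof.
move=> + fg; rewrite unlock; case: q => [r|_|//].
  rewrite lee_fin => r0.
  have rle x y : 0 <= x -> x <= y -> forall s, (0 <= s)%R -> x `^ s <= y `^ s.
    move=> x0 xy s s0; apply: gt0_ler_poweR => //; rewrite in_itv /= leey andbT //.
    exact: le_trans xy.
  apply: (rle) _ _ _ _ _ _; rewrite ?invr_ge0 //.
    by apply: integral_ge0 => x _; exact: poweR_ge0.
  apply: le_lower_integral => [x _|x _|x]; rewrite ?poweR_ge0 // !patch_setT.
  exact: rle.
by case: ifPn => // _; apply: le_ess_sup; exact: nearW.
Qed.

(** Hoelder's inequality against the indicator of [D]. The constant is [1] for [q = 1], a power of
    [mu D] for finite [q > 1], and [mu D] for [q = +oo]. *)
Lemma Lnorm1_le_Lnorm q (D : set T) : 1 <= q -> measurable D -> mu D < +oo ->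
  exists2 c : R, (0 <= c)%R & forall w : T -> R,
    measurable_fun setT w -> (forall x, ~ D x -> w x = 0%R) ->
    'N[mu]_1[EFin \o w] <= c%:E * 'N[mu]_q[EFin \o w].
Proof.
move=> q1 mD Doo; have Dfin : mu D \is a fin_num by rewrite ge0_fin_numE.
case: q q1 => [q|_|//].
  rewrite lee_fin le_eqVlt => /predU1P[<-|q1].
    by exists 1%R => // w _ _; rewrite mul1e.
  pose q' := (q / (q - 1))%R.
  have q0 : (0 < q)%R by exact: lt_trans q1.
  have q'0 : (0 < q')%R by rewrite divr_gt0 ?subr_gt0.
  have qq' : (q^-1 + q'^-1 = 1)%R.
    rewrite /q' invf_div mulrBl divff ?gt_eqF // mul1r addrC subrK //.
  exists (fine (mu D) `^ q'^-1)%R; first exact: powR_ge0.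
  move=> w mw wD.
  have w1 : w = (w \* \1_D)%R.
    apply/funext => x /=; rewrite indicE.
    have [Dx|Dx] := pselect (D x); first by rewrite mem_set // mulr1.
    by rewrite wD // mul0r.
  rewrite {1}w1; apply: (le_trans (hoelder mu mw _ q0 q'0 qq')) => //.
  rewrite muleC lee_wpmul2r ?Lnorm_ge0 // [in leLHS]unlock.
  under eq_integral => x _.
    rewrite /= (_ : `|\1_D x| `^ q' = (\1_D x : R))%R; first over.
    rewrite indicE; case: (x \in D) => /=; first by rewrite normr1 powR1.
    by rewrite normr0 powR0 // gt_eqF.
  by rewrite integral_indic // setIT -poweR_EFin fineK.
exists (fine (mu D)); first exact: fine_ge0.
move=> w mw wD; rewrite Lnorm1.
(* The norm for [q = +oo] is an essential supremum only when the whole space has positive measure,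
   so a null [D] is treated apart. *)
have [D0|D0] := eqVneq (mu D) 0.
  rewrite D0 mul0e (lower_integral_setD_null mD) //.
  by rewrite integral0_eq // => x [_ Dx] /=; rewrite wD // normr0.
have DT : 0 < mu [set: T].
  by apply: (@lt_le_trans _ _ (mu D)); rewrite ?lt0e ?D0 ?measure_ge0 ?le_measure ?inE.
rewrite [in leRHS]unlock DT; set e := ess_sup _ _.
have e0 : 0 <= e by apply: ess_sup_gee => //; apply: nearW => x /=.
have -> : \int[mu]_x `|(EFin \o w) x| = \int[mu]_(x in D) `|(EFin \o w) x|.
  rewrite [RHS]integral_mkcond; apply: eq_integral => x _.
  rewrite /patch; case: ifPn => // /negP; rewrite inE => Dx /=.
  by rewrite wD // normr0.
have -> : (fine (mu D))%:E * e = \int[mu]_(x in D) cst e x.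
  by rewrite integral_cst // fineK // muleC.
apply: ae_ge0_le_integral => //.
  by apply: measurableT_comp => //; apply/measurable_EFinP; exact: measurable_funTS.
by apply: filterS (ess_sup_ge mu (abse \o (EFin \o w))) => x.
Qed.

(** The zero extension of [g] from [D'] is measurable, so the previous bound applies to it. By
    monotonicity its norm is at most that of the extension from [D], where [g] may fail to be
    measurable. *)
Lemma integral_le_Lnorm q (D : set T) : 1 <= q -> measurable D -> mu D < +oo ->
  exists2 c : R, (0 <= c)%R & forall (D' : set T) (g : T -> R),
    measurable D' -> D' `<=` D -> measurable_fun D' g -> (forall x, 0 <= g x)%R ->
    \int[mu]_(x in D') (g x)%:E <= c%:E * 'N[mu]_q[(fun x => (g x)%:E) \_ D].
Proof.
move=> q1 mD Doo; have [c c0 cP] := Lnorm1_le_Lnorm q1 mD Doo.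
exists c => // D' g mD' D'D mg g0.
have w0 x : ~ D x -> (g \_ D') x = 0%R.
  by move=> Dx; rewrite /patch memNset // => /D'D.
have := cP _ ((measurable_restrictT _ mD').1 mg) w0.
rewrite Lnorm1 (integral_mkcond D').
have -> : \int[mu]_x `|(EFin \o g \_ D') x| =
    \int[mu]_x ((fun x => (g x)%:E) \_ D') x.
  apply: eq_integral => x _; rewrite /patch /=; case: ifP => _ /=.
    by rewrite ger0_norm.
  by rewrite normr0.
move/le_trans; apply; apply: lee_wpmul2l; first by rewrite lee_fin.
apply: le_Lnorm => [|x]; first exact: le_trans q1.
rewrite /patch /=; case: ifPn => xD'; last by rewrite normr0 abse_ge0.
by rewrite mem_set //; exact/D'D/set_mem.
Qed.

End LnormFiniteMeasure.

(** * Bochner integrals *)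

Section StepFunctions.
Context {R : realType} {E : normedModType R}.
Local Notation mu := (@lebesgue_measure R).
Implicit Types (D : set (measurableTypeR R)) (s : @step_fun R E).

Lemma indic_scale (T : Type) (A : set T) (x : T) (v : E) :
  \1_A x *: v = if x \in A then v else 0.
Proof. by rewrite indicE; case: (x \in A); rewrite ?scale1r ?scale0r. Qed.

(** Working with the real-valued norm avoids a sigma-algebra on [E]. In the induction the line is
    split along the first set, on which [c] absorbs the value [v ord0]. *)
Lemma measurable_norm_step n (A : 'I_n -> set (measurableTypeR R))
    (v : 'I_n -> E) (c : E) : (forall i, measurable (A i)) ->
  measurable_fun [set: measurableTypeR R]
    (fun x : measurableTypeR R => `|c + \sum_(i < n) \1_(A i) x *: v i|).
Proof.
elim: n => [|n IH] in A v c * => mA.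
  under eq_fun do rewrite big_ord0; exact: measurable_cst.
have mA' i : measurable (A (lift ord0 i)) by [].
have := IH _ (v \o lift ord0) (c + v ord0) mA'.
have := IH _ (v \o lift ord0) c mA'.
set f := (fun x => _); set g := (fun x => _) => mf mg.
have -> : (fun x : measurableTypeR R => `|c + \sum_(i < n.+1) \1_(A i) x *: v i|) =
    (fun x => (\1_(A ord0) x * g x + \1_(~` A ord0) x * f x)).
  apply/funext => x; rewrite big_ord_recl indic_scale !indicE in_setC.
  case: (x \in A ord0) => /=; rewrite mul1r mul0r ?addr0 ?add0r.
    by rewrite addrA.
  by [].
apply: measurable_funD; apply: measurable_funM => //; apply: measurable_indic => //.
exact: measurableC.
Qed.

Lemma measurable_norm_step_eval s :
  measurable_fun [set: measurableTypeR R]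
    (fun x : measurableTypeR R => `|step_eval s x|).
Proof.
have := measurable_norm_step (@step_val _ _ s) 0 (@step_setP _ _ s).
by under eq_fun do rewrite add0r.
Qed.

(* Splitting [D] along the first set reduces to fewer sets, the constant [c]
   absorbing the value; this avoids passing to disjoint representations. *)
Lemma norm_step_integral_cst n (A : 'I_n -> set (measurableTypeR R))
    (v : 'I_n -> E) (c : E) D :
  (forall i, measurable (A i)) -> measurable D -> (mu D < +oo)%E ->
  ((`|fine (mu D) *: c + \sum_(i < n) fine (mu (A i `&` D)) *: v i|)%:E <=
   \int[mu]_(x in D) (`|c + \sum_(i < n) \1_(A i) x *: v i|)%:E)%E.
Proof.
elim: n => [|n IH] in A v c D * => mA mD Doo.
  under eq_integral do rewrite big_ord0 addr0.
  rewrite big_ord0 addr0 integral_cst // normrZ ger0_norm ?fine_ge0 //.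
  by rewrite EFinM fineK ?ge0_fin_numE // muleC.
pose D1 := D `&` A ord0; pose D2 := D `\` A ord0.
have mA' i : measurable (A (lift ord0 i)) by [].
have mD1 : measurable D1 by exact: measurableI.
have mD2 : measurable D2 by exact: measurableD.
have sub_oo (B : set (measurableTypeR R)) : measurable B -> B `<=` D ->
    (mu B < +oo)%E.
  by move=> mB BD; apply: le_lt_trans Doo; apply: le_measure; rewrite ?inE.
have D1D : D1 `<=` D by exact: subIsetl.
have D2D : D2 `<=` D by exact: subDsetl.
have D12 : D = D1 `|` D2 by rewrite setUIDK.
have disj : [disjoint D1 & D2].
  apply/disj_setPS => x [[_ ?] [_ ?]] //.
have split_mu (B : set (measurableTypeR R)) : measurable B ->
    fine (mu (B `&` D)) = fine (mu (B `&` D1)) + fine (mu (B `&` D2)).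
  move=> mB; rewrite -fineD; first last.
  - by rewrite ge0_fin_numE // sub_oo //;
      [exact: measurableI | move=> x [_ /D2D]].
  - by rewrite ge0_fin_numE // sub_oo //;
      [exact: measurableI | move=> x [_ /D1D]].
  congr fine; rewrite {1}D12 setIUr measureU //; try exact: measurableI.
  by rewrite -subset0 => x [[_ [_ ?]] [_ [_ ?]]].
have := IH _ (v \o lift ord0) c D2 mA' mD2 (sub_oo _ mD2 D2D).
have := IH _ (v \o lift ord0) (c + v ord0) D1 mA' mD1 (sub_oo _ mD1 D1D).
set S1 := \sum_i _; set S2 := \sum_i _ => I1 I2.
have int1 : (\int[mu]_(x in D1) (`|c + \sum_(i < n.+1) \1_(A i) x *: v i|)%:E =
  \int[mu]_(x in D1)
    (`|c + v ord0 + \sum_(i < n) \1_(A (lift ord0 i)) x *: v (lift ord0 i)|)%:E)%E.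
  apply: eq_integral => x; rewrite inE => -[_ Ax].
  by rewrite big_ord_recl indic_scale mem_set // addrA.
have int2 : (\int[mu]_(x in D2) (`|c + \sum_(i < n.+1) \1_(A i) x *: v i|)%:E =
  \int[mu]_(x in D2)
    (`|c + \sum_(i < n) \1_(A (lift ord0 i)) x *: v (lift ord0 i)|)%:E)%E.
  apply: eq_integral => x; rewrite inE => -[_ Ax].
  by rewrite big_ord_recl indic_scale memNset // add0r.
rewrite [in leRHS]D12 ge0_integral_setU //=; first last.
  apply: measurable_funTS; apply/measurable_EFinP.
  exact: measurable_norm_step.
rewrite int1 int2; apply: le_trans (leeD I1 I2).
rewrite -EFinD lee_fin; apply: le_trans (ler_normD _ _).
rewrite le_eqVlt; apply/orP; left; apply/eqP; congr (`| _ |).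
rewrite big_ord_recl.
have -> : \sum_(i < n) fine (mu (A (lift ord0 i) `&` D)) *: v (lift ord0 i) = S1 + S2.
  by rewrite -big_split /=; apply: eq_bigr => i _; rewrite split_mu // scalerDl.
have := split_mu setT measurableT; rewrite !setTI => ->.
have -> : A ord0 `&` D = D1 by rewrite setIC.
rewrite scalerDr scalerDl -!addrA; congr (_ + _).
by rewrite [LHS]addrCA; congr (_ + _); rewrite [LHS]addrCA.
Qed.

Lemma norm_step_integral D s : measurable D -> (mu D < +oo)%E ->
  ((`|step_integral D s|)%:E <= \int[mu]_(x in D) (`|step_eval s x|)%:E)%E.
Proof.
move=> mD Doo.
have := norm_step_integral_cst (@step_val _ _ s) 0 (@step_setP _ _ s) mD Doo.
by rewrite scaler0 add0r; under eq_integral do rewrite add0r.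
Qed.

Section FinStep.
Context {T : finType} (A : T -> set (measurableTypeR R)) (v : T -> E).
Hypothesis mA : forall i, measurable (A i).

(** Enumerating a finite type gives step functions indexed by sums (for differences) and by products
    (for refinements along a time grid). *)
Definition fin_step : @step_fun R E :=
  StepFun (fun i : 'I_#|T| => v (enum_val i)) (fun i => mA (enum_val i)).

Lemma fin_step_eval x : step_eval fin_step x = \sum_i \1_(A i) x *: v i.
Proof. by rewrite /step_eval /= -(big_enum_val (fun i => \1_(A i) x *: v i)). Qed.

Lemma fin_step_integral D :
  step_integral D fin_step = \sum_i fine (mu (A i `&` D)) *: v i.
Proof.
by rewrite /step_integral /= -(big_enum_val (fun i => fine (mu (A i `&` D)) *: v i)).
Qed.
End FinStep.

Lemma step_subP s t : exists r : @step_fun R E,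
  (forall x, step_eval r x = step_eval s x - step_eval t x) /\
  forall D, step_integral D r = step_integral D s - step_integral D t.
Proof.
pose A (i : 'I_(step_size s) + 'I_(step_size t)) :=
  match i with inl i => step_set i | inr i => step_set i end.
pose v (i : 'I_(step_size s) + 'I_(step_size t)) :=
  match i with inl i => step_val i | inr i => - step_val i end.
have mA i : measurable (A i) by case: i => i; exact: step_setP.
exists (fin_step v mA); split=> [x|D].
  rewrite fin_step_eval big_sumType /=; congr (_ + _).
  by rewrite -sumrN; apply: eq_bigr => i _; rewrite scalerN.
rewrite fin_step_integral big_sumType /=; congr (_ + _).
by rewrite -sumrN; apply: eq_bigr => i _; rewrite scalerN.
Qed.

Lemma step_restrictP s (B : set (measurableTypeR R)) : measurable B ->
  exists r : @step_fun R E,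
    forall x, step_eval r x = if x \in B then step_eval s x else 0.
Proof.
move=> mB.
have mA i : measurable (step_set (s := s) i `&` B).
  by apply: measurableI => //; exact: step_setP.
exists (StepFun (@step_val _ _ s) mA) => x.
rewrite /step_eval /=; case: ifPn => xB.
  by apply: eq_bigr => i _; rewrite !indicE in_setI xB andbT.
by apply: big1 => i _; rewrite indicE in_setI (negbTE xB) andbF scale0r.
Qed.

End StepFunctions.

(** * Existence of the Bochner integral by dominated convergence *)

Section BochnerExistence.
Context {R : realType} {E : normedModType R}.
Local Notation mu := (@lebesgue_measure R).
Implicit Types (D N : set (measurableTypeR R)) (s : nat -> @step_fun R E).

Lemma ae_cvg_step_setD D s f : ae_cvg_step D s f ->
  exists N, [/\ measurable N, mu N = 0 &
    forall x, (D `\` N) x -> step_eval (s n) x @[n --> \oo] --> f x].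
Proof.
move=> [N [mN N0 subN]]; exists N; split=> // x [Dx Nx].
by apply: contra_notP Nx => h; apply: subN => /=; apply: contra_not h; exact.
Qed.

Lemma measurable_norm_step_lim D s (f : R -> E) :
  (forall x, D x -> step_eval (s n) x @[n --> \oo] --> f x) ->
  measurable_fun D (fun x : measurableTypeR R => `|f x|).
Proof.
move=> sf.
apply: (@measurable_fun_cvg _ _ _ _ (fun n x => `|step_eval (s n) x|)).
  by move=> n; apply: measurable_funTS; exact: measurable_norm_step_eval.
by move=> x Dx; apply: cvg_norm; exact: sf.
Qed.

Lemma measurable_norm_sub_step D s (f : R -> E) (t : @step_fun R E) :
  (forall x, D x -> step_eval (s n) x @[n --> \oo] --> f x) ->
  measurable_fun D (fun x : measurableTypeR R => `|f x - step_eval t x|).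
Proof.
move=> sf; have /choice[r rP] n := step_subP (s n) t.
apply: (@measurable_norm_step_lim D r (fun x => f x - step_eval t x)) => x Dx.
under eq_fun do rewrite (rP _).1.
by apply: cvgB; [exact: sf|exact: cvg_cst].
Qed.

End BochnerExistence.

Section BochnerExistenceComplete.
Context {R : realType} {E : completeNormedModType R}.
Local Notation mu := (@lebesgue_measure R).
Implicit Types (D N : set (measurableTypeR R)) (s : nat -> @step_fun R E).

(** Each step function is set to zero where its norm exceeds [2 * |f|], a measurable condition. This
    supplies the domination needed to pass from pointwise to [L^1] convergence. *)
Lemma truncated_steps D s (f : R -> E) : measurable D ->
  (forall x, D x -> step_eval (s n) x @[n --> \oo] --> f x) ->
  exists r : nat -> @step_fun R E,
    forall x, D x -> step_eval (r n) x @[n --> \oo] --> f x /\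
      forall n, `|step_eval (r n) x| <= 2 * `|f x|.
Proof.
move=> mD sf.
have mf : measurable_fun D (fun x : measurableTypeR R => `|f x|).
  exact: measurable_norm_step_lim sf.
pose B n : set (measurableTypeR R) :=
  D `&` [set x | `|step_eval (s n) x| <= 2 * `|f x|].
have mB n : measurable (B n).
  apply: measurable_fun_le => //.
    by apply: measurable_funTS; exact: measurable_norm_step_eval.
  exact: measurable_funM.
have /choice[r rP] n := step_restrictP (s n) (mB n).
have rB n x : D x -> `|step_eval (r n) x| <= 2 * `|f x|.
  move=> Dx; rewrite rP; case: ifPn => [|_]; first by rewrite inE => -[].
  by rewrite normr0 mulr_ge0.
exists r => x Dx; split=> [|n]; last exact: rB.
(* Where [f] vanishes the bound forces all truncated values to be zero; elsewhere
   [|f x| < 2 * |f x|], so the truncation is eventually inactive. *)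
have [fx0|fx0] := eqVneq (f x) 0.
  have r0 n : step_eval (r n) x = 0.
    by apply/eqP; have := rB n _ Dx; rewrite fx0 normr0 mulr0 normr_le0.
  by under eq_fun do rewrite r0; rewrite fx0; exact: cvg_cst.
apply: cvg_trans (sf _ Dx); apply: near_eq_cvg; near=> n.
rewrite /= rP mem_set //; split=> //=; apply: ltW.
near: n; apply: (cvgr_lt _ (cvg_norm (sf _ Dx))).
by rewrite ltr_pMl ?normr_gt0 // ltr1n.
Unshelve. all: by end_near. Qed.

Lemma bochner_exists D N s (f : R -> E) :
  measurable D -> (mu D < +oo)%E -> measurable N -> mu N = 0 ->
  (forall x, (D `\` N) x -> step_eval (s n) x @[n --> \oo] --> f x) ->
  (\int[mu]_(x in D `\` N) (`|f x|)%:E < +oo)%E ->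
  exists2 v, is_bochner_integral D f v &
    ((`|v|)%:E <= \int[mu]_(x in D `\` N) (`|f x|)%:E)%E.
Proof.
move=> mD Doo mN N0 sf0 foo.
pose D' := D `\` N; have mD' : measurable D' by exact: measurableD.
have [r rP] := truncated_steps mD' sf0.
have rf x (Dx : D' x) := (rP x Dx).1.
have r2 x n (Dx : D' x) := (rP x Dx).2 n.
have mf : measurable_fun D' (fun x : measurableTypeR R => `|f x|).
  exact: measurable_norm_step_lim rf.
have mfr n := measurable_norm_sub_step (r n) rf.
have mr n : measurable_fun D' (fun x : measurableTypeR R => `|step_eval (r n) x|).
  by apply: measurable_funTS; exact: measurable_norm_step_eval.
pose I := (\int[mu]_(x in D') (`|f x|)%:E)%E.
pose a n := (\int[mu]_(x in D') (`|f x - step_eval (r n) x|)%:E)%E.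
have I0 : (0 <= I)%E by apply: integral_ge0 => x _; rewrite lee_fin.
have intf : mu.-integrable D' (fun x => (`|f x|)%:E).
  apply/integrableP; split; first exact/measurable_EFinP.
  by under eq_integral do rewrite gee0_abs ?lee_fin //.
(* Dominated convergence with the majorant [3 * |f|], from [|f| + |r n| <= |f| + 2 * |f|]. *)
have a_cvg : a n @[n --> \oo] --> 0%E.
  have dc := @dominated_convergence _ _ _ mu D' mD'
    (fun n x => (`|f x - step_eval (r n) x|)%:E) (cst 0%E)
    (fun x => (3%:E * (`|f x|)%:E)%E).
  have [] := dc.
  - by move=> n; exact/measurable_EFinP.
  - exact: measurable_cst.
  - apply/aeW => x Dx; apply/(fine_cvgP _ 0); split=> /=; first exact: nearW.
    rewrite -[X in _ --> X](normr0 E) -[X in `|X|](subrr (f x)).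
    by apply: cvg_norm; apply: cvgB; [exact: cvg_cst|exact: rf].
  - exact: integrableZl.
  - apply/aeW => x n Dx /=; rewrite normr_id -EFinM lee_fin.
    have -> : (3 : R) = 1 + 2 by rewrite -natr1 addrC.
    by rewrite (le_trans (ler_normB _ _)) // mulrDl mul1r lerD2l r2.
  - by move=> _ _; rewrite integral0.
(* The Bochner integral is taken over [D], measurability is known off [N] only; the lower integral
   does not see the difference. *)
have af n : (\int[mu]_(x in D) (`|f x - step_eval (r n) x|)%:E = a n)%E.
  by rewrite (lower_integral_setD_null mN) // => x _; rewrite lee_fin.
have ra n : (\int[mu]_(x in D) (`|step_eval (r n) x|)%:E <= I + a n)%E.
  rewrite (lower_integral_setD_null mN) => [|//|x _]; last by rewrite lee_fin.
  rewrite -ge0_integralD //; try exact/measurable_EFinP.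
  apply: ge0_le_integral => //; first exact/measurable_EFinP.
    by apply/measurable_EFinP; exact: measurable_funD.
  move=> x _; rewrite -EFinD lee_fin -[X in `|X| <= _](subKr (f x)).
  exact: ler_normB.
(* The difference of two step functions is again one, and its integral is bounded by the integral of
   its norm; hence the step integrals are Cauchy. *)
have step_cauchy m n : ((`|step_integral D (r m) - step_integral D (r n)|)%:E
    <= a m + a n)%E.
  have [t [tE <-]] := step_subP (r m) (r n).
  apply: (le_trans (norm_step_integral t mD Doo)).
  rewrite (lower_integral_setD_null mN) => [|//|x _]; last by rewrite lee_fin.
  rewrite -ge0_integralD //; try exact/measurable_EFinP.
  apply: ge0_le_integral => //.
  - apply/measurable_EFinP; apply: measurable_funTS.
    exact: measurable_norm_step_eval.
  - by apply/measurable_EFinP; exact: measurable_funD.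
  - move=> x _; rewrite tE -EFinD lee_fin (distrC (f x)).
    by rewrite -(subrKA (f x)) (le_trans (ler_normD _ _)).
have [afin fa_cvg] := (fine_cvgP _ _).1 a_cvg.
have si_cvg : cvgn (fun n => step_integral D (r n)).
  apply: cauchy_cvg; apply: cauchy_exP => e e0.
  have [M _ MP] := filterI afin (cvgr0_norm_lt _ fa_cvg (e / 2) (divr_gt0 e0 (ltr0Sn _ _))).
  have aM n : (M <= n)%N -> (a n < (e / 2)%:E)%E.
    move=> /MP[/= anfin] /=; rewrite -(fineK anfin) lte_fin.
    exact: le_lt_trans (ler_norm _).
  exists (step_integral D (r M)), M => // n /= Mn.
  rewrite -ball_normE /= -lte_fin (le_lt_trans (step_cauchy _ _)) //.
  by rewrite [e]splitr EFinD lteD // aM.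
exists (limn (fun n => step_integral D (r n))).
  exists r; split=> //; last by under eq_fun do rewrite af.
  exists N; split=> // x /= h; apply: contrapT => Nx; apply: h => Dx.
  exact: rf.
have Ifin : I \is a fin_num by rewrite ge0_fin_numE.
rewrite -/I -(fineK Ifin) lee_fin -[fine I]addr0.
(* The bound on [v] is the limit of [|step_integral D (r n)| <= I + a n]. *)
have nl := cvg_norm si_cvg.
have nr : fine I + fine (a n) @[n --> \oo] --> fine I + 0.
  by apply: cvgD => //; exact: cvg_cst.
apply: (ler_cvg_to (nl _) nr).
near=> n; rewrite /= -lee_fin EFinD !fineK //; last by near: n.
exact: (le_trans (norm_step_integral _ mD Doo)).
Unshelve. all: by end_near. Qed.

End BochnerExistenceComplete.

(** * Step approximation of [F x (u x)] for a time-dependent operator [F] *)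

Section Sampling.
Context {R : realType} {U Y : normedModType R}.
Variables (F : R -> U -> Y) (tau K : R).
Hypothesis F_linear : forall t, linear (F t).

Let F_sum t n (f : 'I_n -> U) : F t (\sum_(i < n) f i) = \sum_(i < n) F t (f i).
Proof. exact: (big_morph (F t) (linear_funD (F_linear t)) (linear_fun0 (F_linear t))). Qed.

(** Time in [F] is frozen at the left end [y] of the cell of a grid of mesh [1 / (n + 1)] that
    contains [x]. Intersecting the sets of [s] with the cells yields a step function. *)
Lemma sampled_step (s : @step_fun R U) (n : nat) : exists r : @step_fun R Y,
  forall x, 0 <= x <= tau -> exists y, [/\ 0 <= y <= x, x < y + n.+1%:R^-1 &
    step_eval r x = F y (step_eval s x)].
Proof.
have n0 : 0 < (n.+1%:R : R) by [].
(* The successor makes the half-open cells cover the end point [tau] as well. *)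
pose m := (Num.trunc (n.+1%:R * tau)).+1.
pose P (k : 'I_m) : set (measurableTypeR R) :=
  `[k%:R / n.+1%:R, k.+1%:R / n.+1%:R[%classic.
pose A (ik : 'I_(step_size s) * 'I_m) := step_set ik.1 `&` P ik.2.
pose v (ik : 'I_(step_size s) * 'I_m) := F (ik.2%:R / n.+1%:R) (step_val ik.1).
have mA ik : measurable (A ik).
  by apply: measurableI; [exact: step_setP|exact: measurable_itv].
exists (fin_step v mA) => x /andP[x0 xtau].
have nx0 : 0 <= n.+1%:R * x by rewrite mulr_ge0.
have xm : (Num.trunc (n.+1%:R * x) < m)%N by rewrite ltnS le_truncn // ler_pM2l.
pose k0 := Ordinal xm.
have PE k : (x \in P k) = (k == k0).
  rewrite -val_eqE /= eq_sym truncn_eq //.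
  apply/idP/idP; rewrite inE /P /= in_itv /= ler_pdivrMr // ltr_pdivlMr //;
  by rewrite [x * _]mulrC.
have /andP[xk0 xk1] : k0%:R / n.+1%:R <= x < k0.+1%:R / n.+1%:R.
  have : x \in P k0 by rewrite PE.
  by rewrite inE /P /= in_itv.
exists (k0%:R / n.+1%:R); split.
- by rewrite divr_ge0.
- by rewrite -[X in _ + X]mul1r -mulrDl natr1.
rewrite fin_step_eval -(pair_bigA _ (fun i k => \1_(A (i, k)) x *: v (i, k))) /=.
rewrite exchange_big (bigD1 k0) //= [X in _ + X]big1 ?addr0; last first.
  move=> k kk0; apply: big1 => i _.
  by rewrite indicE in_setI /= PE (negbTE kk0) andbF scale0r.
rewrite /step_eval F_sum; apply: eq_bigr => i _.
by rewrite (linear_funZ (F_linear _)) !indicE in_setI /= PE eqxx andbT.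
Qed.

(** With [y n] the sampling times, [F (y n) (s n x)] splits into [F (y n) (s n x - u x)], small by
    the uniform bound [K], and [F (y n) (u x)], which converges by strong continuity. *)
Lemma sampled_steps (D : set (measurableTypeR R)) (s : nat -> @step_fun R U)
    (u : R -> U) :
  (forall t v, 0 <= t <= tau -> `|F t v| <= K * `|v|) ->
  (forall v, continuous (F^~ v)) -> D `<=` `[0, tau] ->
  (forall x, D x -> step_eval (s n) x @[n --> \oo] --> u x) ->
  exists r : nat -> @step_fun R Y,
    forall x, D x -> step_eval (r n) x @[n --> \oo] --> F x (u x).
Proof.
move=> FK Fc Dtau su; have /choice[r rP] n := sampled_step (s n) n.
exists r => x Dx; have xtau : 0 <= x <= tau by have := Dtau x Dx; rewrite /= in_itv.
have /choice[y yP] n := rP n x xtau.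
have y_cvg : y n @[n --> \oo] --> x.
  apply/cvgrPdist_lt => e e0; near=> n.
  have [/andP[_ yx] xy _] := yP n.
  rewrite ger0_norm ?subr_ge0 // ltrBlDl (lt_trans xy) // ltrD2l.
  by near: n; exact: (near_infty_natSinv_lt (PosNum e0)).
have -> : (fun n => step_eval (r n) x) =
    (fun n => F (y n) (step_eval (s n) x - u x) + F (y n) (u x)).
  by apply/funext => n; have [_ _ ->] := yP n; rewrite -(linear_funD (F_linear _)) subrK.
rewrite -[X in _ --> X]add0r; apply: cvgD; last first.
  exact: (@cvg_comp _ _ _ y (F^~ (u x)) _ _ _ y_cvg (Fc (u x) x)).
apply: norm_cvg0.
apply: (@squeeze_cvgr _ _ _ _ (cst 0) (fun n => K * `|step_eval (s n) x - u x|)).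
- apply: nearW => n; rewrite normr_ge0 /=; apply: FK.
  have [/andP[y0 yx] _ _] := yP n; rewrite y0 /= (le_trans yx) //.
  by case/andP: xtau.
- exact: cvg_cst.
- rewrite -[X in _ --> X](mulr0 K); apply: cvgM; first exact: cvg_cst.
  rewrite -(normr0 U) -(subrr (u x)); apply: cvg_norm.
  by apply: cvgB; [exact: su|exact: cvg_cst].
Unshelve. all: by end_near. Qed.

End Sampling.

(** * Exponential of a bounded operator *)

Section ExponentialOperator.
Context {R : realType} {X : completeNormedModType R} (T : X -> X) (M : R).
Hypotheses (T_linear : linear T) (M_ge0 : 0 <= M).
Hypothesis T_bounded : forall x, `|T x| <= M * `|x|.

Lemma iter_linear n : linear (iter n T).
Proof. by elim: n => [|n IH] a x y //=; rewrite IH T_linear. Qed.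

Lemma iter_norm n x : `|iter n T x| <= M ^+ n * `|x|.
Proof.
elim: n => [|n IH] /=; first by rewrite expr0 mul1r.
by rewrite (le_trans (T_bounded _)) // exprS -mulrA ler_wpM2l.
Qed.

Lemma series_norm_le (u : nat -> X) (b : nat -> R) :
  (forall n, `|u n| <= b n) -> cvgn (series b) ->
  cvgn (series u) /\ `|limn (series u)| <= limn (series b).
Proof.
move=> ub cb.
have b0 n : 0 <= b n by exact: le_trans (ub n).
have nu : cvgn [normed series u].
  by apply: (@series_le_cvg _ (fun n => `|u n|) b) => // n.
split; first exact: normed_cvg.
by apply: le_trans (lim_series_norm nu) _; apply: lim_series_le.
Qed.

Lemma series_exp_coeff_scale (t c : R) :
  cvgn (series (fun n => exp_coeff t n * c)) /\
  limn (series (fun n => exp_coeff t n * c)) = expR t * c.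
Proof.
have ct := @is_cvg_series_exp_coeff _ t.
have -> : (fun n => exp_coeff t n * c) = c *: (exp_coeff t : nat -> R).
  by apply/funext => n; rewrite /GRing.scale /= mulrC.
by split; [exact: is_cvg_seriesZ|rewrite lim_seriesZ // mulrC].
Qed.

Lemma exp_op_term_norm t n x :
  `|exp_coeff t n *: iter n T x| <= exp_coeff (`|t| * M) n * `|x|.
Proof.
rewrite normrZ /exp_coeff /= normrM normrX exprMn.
rewrite [`|n`!%:R^-1|]ger0_norm ?invr_ge0 //.
rewrite (_ : `|t| ^+ n * M ^+ n / n`!%:R * `|x| =
    (`|t| ^+ n / n`!%:R) * (M ^+ n * `|x|)); last by ring.
by rewrite ler_wpM2l ?iter_norm // mulr_ge0 ?exprn_ge0 ?invr_ge0.
Qed.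

Lemma exp_op_cvg t x : cvgn (series (fun n => exp_coeff t n *: iter n T x)).
Proof.
have [c _] := series_exp_coeff_scale (`|t| * M) `|x|.
by have [] := series_norm_le (fun n => exp_op_term_norm t n x) c.
Qed.

Lemma exp_op_norm t x : `|exp_op T t x| <= expR (`|t| * M) * `|x|.
Proof.
have [c <-] := series_exp_coeff_scale (`|t| * M) `|x|.
by have [] := series_norm_le (fun n => exp_op_term_norm t n x) c.
Qed.

Lemma exp_op_linear t : linear (exp_op T t).
Proof.
move=> a x y; apply: cvg_lim; first exact: norm_hausdorff.
have -> : series (fun n => exp_coeff t n *: iter n T (a *: x + y)) =
    (fun n => a *: series (fun n => exp_coeff t n *: iter n T x) n +
              series (fun n => exp_coeff t n *: iter n T y) n).
  apply/funext => n; rewrite /series /= scaler_sumr -big_split /=.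
  by apply: eq_bigr => i _; rewrite iter_linear scalerDr !scalerA mulrC.
apply: cvgD; last exact: exp_op_cvg.
by apply: cvgZr; exact: exp_op_cvg.
Qed.

(** The crude base [2 * r] replaces the factor [n * r ^ (n - 1)], so that summing over the
    exponential coefficients gives an exponential again. *)
Lemma expr_sub_norm (r s t : R) n : 1 <= r -> `|s| <= r -> `|t| <= r ->
  `|t ^+ n - s ^+ n| <= `|t - s| * (2 * r) ^+ n.
Proof.
move=> r1 sr tr; have r0 : 0 <= r by exact: le_trans r1.
elim: n => [|n IH]; first by rewrite !expr0 subrr normr0 mulr1.
have -> : t ^+ n.+1 - s ^+ n.+1 = t * (t ^+ n - s ^+ n) + s ^+ n * (t - s).
  by rewrite !exprS; ring.
apply: (le_trans (ler_normD _ _)); rewrite !normrM normrX.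
have rn : `|s| ^+ n <= (2 * r) ^+ n.
  by rewrite lerXn2r ?nnegrE ?mulr_ge0 // (le_trans sr) // ler_peMl // ler1n.
have -> : `|t - s| * (2 * r) ^+ n.+1 =
    r * (`|t - s| * (2 * r) ^+ n) + r * ((2 * r) ^+ n * `|t - s|).
  by rewrite exprS; ring.
apply: lerD; first exact: ler_pM.
apply: (@le_trans _ _ ((2 * r) ^+ n * `|t - s|)); first by rewrite ler_wpM2r.
by rewrite ler_peMl // mulr_ge0 // exprn_ge0 // mulr_ge0.
Qed.

Lemma exp_op_lipschitz r s t x : 1 <= r -> `|s| <= r -> `|t| <= r ->
  `|exp_op T t x - exp_op T s x| <= `|t - s| * (expR (2 * r * M) * `|x|).
Proof.
move=> r1 sr tr; have r0 : 0 <= r by exact: le_trans r1.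
have [c lE] := series_exp_coeff_scale (2 * r * M) (`|t - s| * `|x|).
rewrite mulrCA -lE.
pose u n := (exp_coeff t n - exp_coeff s n) *: iter n T x.
have ub n : `|u n| <= exp_coeff (2 * r * M) n * (`|t - s| * `|x|).
  rewrite /u /exp_coeff /= -mulrBl normrZ normrM [`|_^-1|]ger0_norm ?invr_ge0 //.
  rewrite [(2 * r * M) ^+ n]exprMn.
  have -> : (2 * r) ^+ n * M ^+ n / n`!%:R * (`|t - s| * `|x|) =
      (`|t - s| * (2 * r) ^+ n / n`!%:R) * (M ^+ n * `|x|).
    by ring.
  rewrite ler_pM // ?mulr_ge0 ?invr_ge0 //; last exact: iter_norm.
  by rewrite ler_wpM2r ?invr_ge0 // expr_sub_norm.
have [_] := series_norm_le ub c; apply: le_trans.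
rewrite le_eqVlt; apply/orP; left; apply/eqP; congr (`| _ |).
apply/esym/cvg_lim; first exact: norm_hausdorff.
have -> : series u = (fun n => series (fun n => exp_coeff t n *: iter n T x) n -
                               series (fun n => exp_coeff s n *: iter n T x) n).
  apply/funext => n; rewrite /series /= -sumrB.
  by apply: eq_bigr => i _; rewrite /u scalerBl.
by apply: cvgB; exact: exp_op_cvg.
Qed.

Lemma exp_op_continuous x : continuous (fun t => exp_op T t x).
Proof.
move=> t; apply/cvgrPdist_lt => e e0.
(* This [r] gives one Lipschitz constant for all [s] within distance 1 of [t]. *)
pose r := `|t| + 1; have r1 : 1 <= r by rewrite lerDr.
pose c := expR (2 * r * M) * `|x| + 1.
have c0 : 0 < c by rewrite ltr_wpDl // mulr_ge0 // expR_ge0.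
have near_t d : 0 < d -> \forall s \near t, `|t - s| < d.
  by move=> d0; have := nbhsx_ballx t d d0.
apply: filterS2 (near_t _ ltr01) (near_t _ (divr_gt0 e0 c0)) => s s1 sc.
have sr : `|s| <= r.
  rewrite -(subrK t s) (le_trans (ler_normD _ _)) // addrC lerD2l.
  by rewrite distrC ltW.
have tr : `|t| <= r by rewrite lerDl.
rewrite (le_lt_trans (exp_op_lipschitz x r1 sr tr)) //.
apply: (@le_lt_trans _ _ (`|t - s| * c)); first by rewrite ler_wpM2l // lerDl.
by rewrite -ltr_pdivlMr.
Qed.

End ExponentialOperator.

(** * The inverse of the generator *)

Section StableGenerator.
Context {R : realType} {X : completeNormedModType R}.
Variables (A : operator X) (S : R -> X -> X).
Hypotheses (S_C0 : C0_semigroup S) (S_stable : exponentially_stable S).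

(** Induction adds the term [S (n * t) (x - S t x)], which the uniform bound [M] controls. *)
Lemma C0_semigroup_telescope M t x n :
    0 <= t -> (forall s y, 0 <= s -> `|S s y| <= M * `|y|) ->
  `|x - S (n%:R * t) x| <= n%:R * (M * `|x - S t x|).
Proof.
move=> t0 SM; have [Slin S0 SD _] := S_C0.
elim: n => [|n IH]; first by rewrite !mul0r S0 subrr normr0.
have nt0 : 0 <= n%:R * t by rewrite mulr_ge0.
have -> : x - S (n.+1%:R * t) x =
    (x - S (n%:R * t) x) + S (n%:R * t) (x - S t x).
  rewrite (linear_funB (proj1 (Slin _ nt0))) addrA subrK.
  by rewrite -SD // -natr1 mulrDl mul1r.
rewrite (le_trans (ler_normD _ _)) // -natr1 mulrDl mul1r.
by rewrite lerD // SM.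
Qed.

(* [x - S t0 x] is a sum of [n] terms [S (i t0/n) (x - S (t0/n) x)], bounded in
   the limit by a multiple of [|A x|], while [S t0] is a strict contraction. *)
Lemma stable_generator_bounded_below :
  exists2 C, 0 <= C & forall x y, generator S (x, y) -> `|x| <= C * `|y|.
Proof.
have [M [w [w0 Mw]]] := S_stable; have [Slin S0 SD _] := S_C0.
have SM s y : 0 <= s -> `|S s y| <= `|M| * `|y|.
  move=> s0; rewrite (le_trans (Mw _ _ s0)) // ler_wpM2r //.
  rewrite (le_trans (ler_norm _)) // normrM ler_piMr // ger0_norm ?expR_ge0 //.
  by rewrite -expR0 ler_expR mulNr oppr_le0 mulr_ge0 // ltW.
(* Chosen so that [w * t0 = 2 * (|M| + 1)]; then [expR z >= 1 + z] gives
   [M * expR (- w * t0) <= 1 / 2]. *)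
pose t0 : R := 2 * (`|M| + 1) / w.
have M1 : 0 < `|M| + 1 by rewrite ltr_wpDl.
have t00 : 0 < t0 by rewrite divr_gt0 // mulr_gt0.
have half : M * expR (- w * t0) <= 2^-1.
  have e1 : w * t0 = 2 * (`|M| + 1) by rewrite mulrC divfK // gt_eqF.
  rewrite mulNr e1 expRN.
  have ge : 2 * (`|M| + 1) <= expR (2 * (`|M| + 1)).
    by rewrite (le_trans _ (expR_ge1Dx _)) // lerDr.
  rewrite ler_pdivrMr ?expR_gt0 // mulrC ler_pdivlMr //.
  apply: le_trans ge; rewrite mulrC ler_pM2l // (le_trans (ler_norm M)) //.
  by rewrite lerDl.
exists (2 * (`|M| * t0)); first by rewrite mulr_ge0 // mulr_ge0 // ltW.
move=> x y gxy.
have key : `|x - S t0 x| <= `|M| * t0 * `|y|.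
  have Mt : 0 < `|M| * t0 + 1 by rewrite ltr_wpDl // mulr_ge0 // ltW.
  apply/ler_addgt0Pr => e e0.
  have : \forall h \near 0^'+, `|h^-1 *: (S h x - x)| < `|y| + e / (`|M| * t0 + 1).
    by apply: (cvgr_lt _ (cvg_norm gxy)); rewrite ltrDl divr_gt0.
  move=> [d /= d0 dP].
  have [N _ NP] := near_infty_natSinv_lt (PosNum (divr_gt0 d0 t00)).
  (* The step [h] divides [t0] exactly and is small enough for the bound on the difference quotient.
     The slack [e / (|M| * t0 + 1)] becomes at most [e] after multiplication by [|M| * t0]. *)
  pose h := t0 / N.+1%:R; have h0 : 0 < h by rewrite divr_gt0.
  have hd : h < d by rewrite /h mulrC -ltr_pdivlMr //; exact: (NP N (leqnn N)).
  have t0h : t0 = N.+1%:R * h by rewrite mulrC divfK.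
  have /ltW hP : `|h^-1 *: (S h x - x)| < `|y| + e / (`|M| * t0 + 1).
    by apply: dP => //=; rewrite sub0r normrN gtr0_norm.
  have dist_h : `|x - S h x| <= h * (`|y| + e / (`|M| * t0 + 1)).
    by rewrite distrC -ler_pdivrMl // -[h^-1]gtr0_norm ?invr_gt0 // -normrZ.
  rewrite {1}t0h (le_trans (C0_semigroup_telescope x N.+1 (ltW h0) SM)) //.
  have -> : N.+1%:R * (`|M| * `|x - S h x|) = `|M| * (N.+1%:R * `|x - S h x|).
    by rewrite mulrCA.
  apply: (@le_trans _ _ (`|M| * (t0 * (`|y| + e / (`|M| * t0 + 1))))).
    by rewrite ler_wpM2l // {1}t0h -mulrA ler_wpM2l.
  rewrite mulrA mulrDr lerD2l mulrCA ler_piMr ?(ltW e0) //.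
  by rewrite ler_pdivrMr // mul1r lerDl.
have : `|x| <= `|x - S t0 x| + `|S t0 x|.
  by rewrite -{1}(subrK (S t0 x) x) ler_normD.
have St0 : `|S t0 x| <= 2^-1 * `|x|.
  by rewrite (le_trans (Mw _ _ (ltW t00))) // ler_wpM2r.
(* From [|x| <= a * |y| + |x| / 2], the last term is absorbed on the left. *)
by move: key St0; set a := `|M| * t0; lra.
Qed.

End StableGenerator.

Section Inverse.
Context {R : realType} {X : completeNormedModType R}.
Implicit Types (A : operator X) (T Q : X -> X).

(** This turns membership in the graph of [A] into an equation for the bounded operator [Q], from
    which linearity and closedness of [A] are read off. *)
Lemma resolvent_opp_op A lam Q : is_resolvent (opp_op A) lam Q ->
  forall x y, A (x, y) <-> Q (y + lam *: x) = x.
Proof.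
move=> [_ QP] x y; rewrite QP /opp_op /= opprB addrK.
by [].
Qed.

(* The lower bound makes the range of [A] closed, so density gives surjectivity. *)
Lemma bounded_below_inverse A lam Q C :
  is_resolvent (opp_op A) lam Q -> dense (range_op A) ->
  (forall x y, A (x, y) -> `|x| <= C * `|y|) ->
  bounded_linear (op_fun (inv_op A)) /\
  forall x y, A (x, y) <-> op_fun (inv_op A) y = x.
Proof.
move=> Qres Adense AC; have AQ := resolvent_opp_op Qres.
have [[Ql Qc] _] := Qres.
have Alin a x x' y y' : A (x, y) -> A (x', y') -> A (a *: x + x', a *: y + y').
  move=> /AQ Axy /AQ Axy'; apply/AQ; rewrite -{2}Axy -{2}Axy' -Ql.
  by rewrite !scalerDr !scalerA [lam * a]mulrC addrACA.
have Asub x x' y y' : A (x, y) -> A (x', y') -> A (x - x', y - y').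
  by move=> Axy /(Alin (-1)) /(_ Axy); rewrite !scaleN1r ![- _ + _]addrC.
have Afun x x' y : A (x, y) -> A (x', y) -> x = x'.
  move=> Ax Ax'; apply/eqP; rewrite -subr_eq0 -normr_le0.
  by have := AC _ _ (Asub _ _ _ _ Ax Ax'); rewrite subrr normr0 mulr0.
have Aonto y : exists x, A (x, y).
  have [v vA vy] := dense_seq y Adense.
  have [x xP] := choice vA.
  have /cvg_ex[l xl] : cvgn x.
    apply: (@cvg_of_dist_le _ _ _ _ v C); first by apply/cvg_ex; exists y.
    by move=> m n; apply: AC; exact: Asub.
  exists l; apply/AQ.
  (* Closedness of [A]: the equation [Q (v n + lam *: x n) = x n] passes to the limit by continuity
     of [Q]. *)
  have lim1 : v n + lam *: x n @[n --> \oo] --> y + lam *: l.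
    by apply: cvgD => //; exact: cvgZr.
  have := cvg_comp _ _ lim1 (Qc (y + lam *: l)).
  rewrite (_ : Q \o _ = x); last by apply/funext => n; exact/AQ.
  move=> xQ; rewrite -[RHS](cvg_lim (@norm_hausdorff _ _) xl).
  exact/esym/cvg_lim.
have AT y : A (op_fun (inv_op A) y, y).
  by have [x Axy] := Aonto y; apply: (@xgetPex _ 0 [set z | inv_op A (y, z)]); exists x.
have ATP x y : A (x, y) <-> op_fun (inv_op A) y = x.
  by split=> [/(Afun _ _ _ (AT y))|<-].
split=> //; apply: (@bounded_linearP _ _ _ _ _ C) => [a y y'|y].
  by apply/ATP; apply: Alin.
exact: AC.
Qed.

Section Extrapolation.
Context {E : completeNormedModType R}.
Variables (A : operator X) (T : X -> X).
Hypotheses (T_lin : bounded_linear T) (AT : forall x y, A (x, y) <-> T y = x).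

(** The resolvent identity [T x = Q x + lam *: T (Q x)] bounds [|T x|] by a multiple of
    [|Q x| = |j x|], so [extend j T] is a genuine extension and not the default zero map. *)
Lemma extend_inverse_bounded (j : {linear X -> E}) :
  is_extrapolation A j -> bounded_linear (extend j T).
Proof.
move=> [lam [Q [Qres jQ jd]]]; have [Tl Tc] := T_lin.
have [C C0 TC] := bounded_linear_norm Tl Tc.
apply: (proj1 (extendP (M := 1 + `|lam| * C) jd Tl _)) => x; rewrite jQ.
have AQx : A (Q x, x - lam *: Q x).
  by apply/(resolvent_opp_op Qres); rewrite subrK.
have -> : T x = Q x + lam *: T (Q x).
  by move/AT : AQx; rewrite (linear_funB Tl) (linear_funZ Tl) => TQ; rewrite -{1}TQ subrK.
rewrite (le_trans (ler_normD _ _)) // mulrDl mul1r lerD2l normrZ -mulrA.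
by rewrite ler_wpM2l.
Qed.

(* [A^-1] being bounded, the extrapolation norm of [A^-1] is equivalent to the
   norm of [X]. *)
Lemma extrapolation_inv_op (k : {linear X -> E}) : is_extrapolation (inv_op A) k ->
  exists K c : R, [/\ 0 <= K, 0 <= c, forall x, `|k x| <= K * `|x|,
    forall x, `|x| <= c * `|k x| & forall y, exists x, k x = y].
Proof.
move=> [lam [Q [Qres kQ kd]]]; have [Tl Tc] := T_lin.
have [C C0 TC] := bounded_linear_norm Tl Tc.
have [[Ql Qc] _] := Qres; have [K K0 QK] := bounded_linear_norm Ql Qc.
have kK x : `|k x| <= K * `|x| by rewrite kQ.
have kc x : `|x| <= (C + `|lam|) * `|k x|.
  (* Here [Q] is a resolvent of [- A^-1], so [x = T (Q x) + lam *: Q x], and [|x|] is bounded by a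
     multiple of [|Q x| = |k x|]. *)
  have : inv_op A (Q x, x - lam *: Q x).
    by apply/(resolvent_opp_op Qres); rewrite subrK.
  move/AT => /= TQ; rewrite kQ -{1}(subrK (lam *: Q x) x) -TQ.
  by rewrite (le_trans (ler_normD _ _)) // normrZ mulrDl lerD2r.
exists K, (C + `|lam|); split=> //; first exact: addr_ge0.
exact: bounded_below_onto kK kc kd.
Qed.

End Extrapolation.
End Inverse.

(** * Admissibility *)

Section BoundedControl.
Context {R : realType} {X U Y : completeNormedModType R}.
Local Notation mu := (@lebesgue_measure R).

(* The integrand is dominated by a multiple of [|u|], and [L^r] embeds into
   [L^1] on [0, tau]. *)
Lemma exp_op_finite_time_admissible (T : X -> X) (k : {linear X -> Y})
    (D : U -> X) (r : \bar R) (K c : R) :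
  bounded_linear T -> bounded_linear D ->
  0 <= K -> 0 <= c -> (forall x, `|k x| <= K * `|x|) ->
  (forall x, `|x| <= c * `|k x|) -> (forall y, exists x, k x = y) ->
  (1 <= r)%E ->
  finite_time_admissible (fun t => exp_op T (- t)) k (k \o D) r.
Proof.
move=> [Tl Tc] [Dl Dc] K0 c0 kK kc konto r1 tau tau0.
have [M M0 TM] := bounded_linear_norm Tl Tc.
have [L L0 DL] := bounded_linear_norm Dl Dc.
pose I : set (measurableTypeR R) := `[0, tau]%classic.
have mI : measurable I by exact: measurable_itv.
have tau_oo : (mu I < +oo)%E.
  by rewrite lebesgue_measure_itv /=; case: ifP => _; rewrite ?ltry.
have [C C0 CP] := integral_le_Lnorm r1 mI tau_oo.
pose K1 := K * (expR (tau * M) * L).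
have K10 : 0 <= K1 by rewrite !mulr_ge0 // expR_ge0.
(* [K1] bounds the integrand by [|u|], [C] embeds [L^r] into [L^1] on [[0, tau]], [c] returns from
   the norm of [Y] to that of [X], and [+ 1] ensures strict positivity. *)
exists (c * K1 * C + 1); first by rewrite ltr_wpDl // !mulr_ge0.
move=> u [[s su] uoo] t /andP[t0 ttau].
have kdense : dense (range k).
  by move=> O [y Oy] _; have [x kx] := konto y; exists y; split=> //; exists x.
(* The exponential is also bounded for the norm [|k x|], so its extension along [k] exists and
   agrees with it on the range of [k], which is all of [Y]. *)
have extE q x : extrapolated_semigroup (fun t => exp_op T (- t)) k q (k x) =
    k (exp_op T (- q) x).
  have kEl : linear (k \o exp_op T (- q)).
    by move=> a y z /=; rewrite (exp_op_linear Tl M0 TM) linearP.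
  have kE_bound y : `|(k \o exp_op T (- q)) y| <=
      K * (expR (`|- q| * M) * c) * `|k y|.
    rewrite /= (le_trans (kK _)) // -!mulrA ler_wpM2l //.
    rewrite (le_trans (exp_op_norm M0 TM _ _)) // ler_wpM2l ?expR_ge0 //.
  exact: (proj2 (extendP kdense kEl kE_bound)).
pose F (q : R) (v : U) : Y := k (exp_op T (- (t - q)) (D v)).
have Fl q : linear (F q).
  by move=> a v w; rewrite /F Dl (exp_op_linear Tl M0 TM) linearP.
have FK1 q v : 0 <= q <= t -> `|F q v| <= K1 * `|v|.
  move=> /andP[q0 qt]; rewrite /F (le_trans (kK _)) // -!mulrA ler_wpM2l //.
  rewrite (le_trans (exp_op_norm M0 TM _ _)) // ler_pM ?expR_ge0 //.
  rewrite ler_expR ler_wpM2r // normrN ger0_norm ?subr_ge0 //.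
  by rewrite lerBlDl (le_trans ttau) // lerDr.
have Fc v : continuous (F^~ v).
  have [_ kcont] := bounded_linearP (linearP k) kK.
  move=> q; have tq : - (t - z) @[z --> q] --> - (t - q).
    by apply: cvgN; apply: cvgB; [exact: cvg_cst|exact: cvg_id].
  have := cvg_comp _ _ tq (@exp_op_continuous _ _ _ _ M0 TM (D v) (- (t - q))).
  by move/cvg_comp; apply; exact: kcont.
have [N [mN N0 sN]] := ae_cvg_step_setD su.
pose D' : set (measurableTypeR R) := `[0, t]%classic `\` N.
have mt : measurable (`[0, t]%classic : set (measurableTypeR R)).
  exact: measurable_itv.
have mD' : measurable D' by exact: measurableD.
have t_tau x : `[0, t]%classic x -> `[0, tau]%classic x.
  by rewrite /= !in_itv /= => /andP[-> /le_trans]; apply.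
have sD' x : D' x -> step_eval (s n) x @[n --> \oo] --> u x.
  by move=> [/t_tau xtau Nx]; exact: sN.
have [w wP] := sampled_steps Fl FK1 Fc (@subDsetl _ _ N) sD'.
have mu_u : measurable_fun D' (fun x : measurableTypeR R => `|u x|).
  exact: measurable_norm_step_lim sD'.
have mF : measurable_fun D' (fun x : measurableTypeR R => `|F x (u x)|).
  exact: measurable_norm_step_lim wP.
have u_le : (\int[mu]_(x in D') (`|u x|)%:E <= C%:E * Lr_norm r tau u)%E.
  by apply: CP => // x [/t_tau].
have Fu_le : (\int[mu]_(x in D') (`|F x (u x)|)%:E <=
    K1%:E * (C%:E * Lr_norm r tau u))%E.
  apply: le_trans (lee_wpmul2l _ u_le); last by rewrite lee_fin.
  rewrite -ge0_integralZl_EFin //; last exact/measurable_EFinP.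
  apply: ge0_le_integral => //; first exact/measurable_EFinP.
    by apply/measurable_EFinP; exact: measurable_funM.
  move=> x [+ _]; rewrite /= in_itv /= => xt.
  by rewrite -EFinM lee_fin FK1.
have t_oo : (mu `[0%R, t]%classic < +oo)%E.
  by rewrite lebesgue_measure_itv /=; case: ifP => _; rewrite ?ltry.
have Lr0 : (0 <= Lr_norm r tau u)%E by exact: Lnorm_ge0.
have Lrfin : Lr_norm r tau u \is a fin_num by rewrite ge0_fin_numE.
have Fu_oo : (\int[mu]_(x in D') (`|F x (u x)|)%:E < +oo)%E.
  by rewrite (le_lt_trans Fu_le) // -(fineK Lrfin) -!EFinM ltry.
have [v vint vle] := bochner_exists mt t_oo mN N0 wP Fu_oo.
have [x kx] := konto v; exists x; split.
  rewrite kx (_ : (fun q => _) = (fun q => F q (u q))) //.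
  by apply/funext => q; rewrite /= extE.
have := le_trans vle Fu_le; move: Lr0; rewrite -(fineK Lrfin) -!EFinM !lee_fin.
set l := fine _ => l0 vl.
apply: (@le_trans _ _ (c * (K1 * (C * l)))).
  by rewrite (le_trans (kc x)) // kx ler_wpM2l.
by rewrite !mulrA ler_wpM2r // lerDl.
Qed.

End BoundedControl.

Theorem theorem5p4 (R : realType) (X U : completeNormedModType R)
    (A : operator X) (S : R -> X -> X)
    (Xm1 : completeNormedModType R) (j : {linear X -> Xm1})
    (B : U -> Xm1) (p p' : \bar R) :
  generates (opp_op A) S ->
  exponentially_stable S ->
  dense (range_op A) ->
  is_extrapolation A j ->
  bounded_linear B ->
  (1 <= p)%E ->
  admissible S j B p ->
  (p^-1 + p'^-1 = 1)%E ->
  forall (Y : completeNormedModType R) (k : {linear X -> Y}),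
    is_extrapolation (inv_op A) k ->
    finite_time_admissible
      (fun t => exp_op (op_fun (inv_op A)) (- t)) k
      (k \o extend j (op_fun (inv_op A)) \o B) p'.
Proof.
move=> [S_C0 AS] S_stable Adense Xm1_ext [Bl Bc] p1 _ pp' Y k Y_ext.
have [C C0 SC] := stable_generator_bounded_below S_C0 S_stable.
have AC x y : A (x, y) -> `|x| <= C * `|y|.
  (* The generator is [- A], whence the sign. *)
  move=> Axy; have : generator S (x, - y) by rewrite -AS /opp_op /= opprK.
  by move=> /SC; rewrite normrN.
have [lam [Q [Qres _ _]]] := Xm1_ext.
have [T_lin AT] := bounded_below_inverse Qres Adense AC.
have [El Ec] := extend_inverse_bounded T_lin AT Xm1_ext.
have [K [c [K0 c0 kK kc konto]]] := extrapolation_inv_op T_lin AT Y_ext.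
have EB : bounded_linear (extend j (op_fun (inv_op A)) \o B).
  split=> [a x y|x]; first by rewrite /= Bl El.
  by apply: continuous_comp; [exact: Bc|exact: Ec].
apply: (exp_op_finite_time_admissible T_lin EB K0 c0 kK kc konto).
(* As [p] is neither [-oo] nor [0], the relation between the inverses identifies [p'] with the
   Hoelder conjugate of [p], which is at least 1. *)
have pNy : (-oo < p)%E by apply: (lt_le_trans _ p1); rewrite ltNyr.
have p0 : p != 0%E by rewrite gt_eqF // (lt_le_trans lte01).
by have /hoelder_conjugateP-> := pp'; rewrite // hoelder_conj_ge1.
Qed.
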